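(* Let $\mathfrak g$ be a finite-dimensional real compact semi-simple Lie algebra with Killing form $\mathbf k$, regarded as a pseudo-Riemannian manifold with the constant metric $\mathbf g=\mathbf k$ and endowed with the Poisson bracket $$\{F,H\}_{\mathfrak g}(L)=\mathbf k\big(L,[\nabla F(L),\nabla H(L)]\big),\qquad F,H\in C^\infty(\mathfrak g),\ L\in\mathfrak g,$$ where $\nabla$ denotes the gradient with respect to $\mathbf k$. Let $\Sigma\subset\mathfrak g$ be a regular adjoint orbit. Then the double bracket metric $\boldsymbol\tau^{\Sigma}_{db}$ and the normal metric $\mathbf n^{\Sigma}$ on $\Sigma$ satisfy $$\boldsymbol\tau^{\Sigma}_{db}=-\mathbf n^{\Sigma}.$$
   Context: The adjoint orbits of $\mathfrak g$ are the symplectic leaves of $\{\cdot,\cdot\}_{\mathfrak g}$. A symplectic leaf (adjoint orbit) $\Sigma$ is regular if the rank of the Poisson tensor is constant in a neighbourhood of each point of $\Sigma$. The gradient with respect to $\mathbf k$ is defined by $\mathbf k(\nabla F(L),\eta)=dF(L)(\eta)$ for all $\eta\in\mathfrak g$; the Hamiltonian vector field is $X_H(L)=-[L,\nabla H(L)]$, with $dF(X_H)=\{F,H\}_{\mathfrak g}$. Double bracket metric: let $\omega\in\Omega^2(\Sigma)$ be the symplectic form induced on the leaf $\Sigma$ (so $\omega(X_F,X_H)=\{F,H\}_{\mathfrak g}$ along $\Sigma$, up to an overall sign convention which does not affect what follows), let $\mathbf g^{\Sigma}_{ind}$ be the metric induced on $\Sigma$ by $\mathbf g=\mathbf k$ (which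 is negative definite, since $\mathfrak g$ is compact), and let $(\mathbf g^{\Sigma}_{ind})^{-1}$ be the associated co-metric tensor on $T^*\Sigma$. Then for $x\in\Sigma$ and $X,Y\in\mathcal X(\Sigma)$, $$\boldsymbol\tau^{\Sigma}_{db}(x)(X(x),Y(x)):=(\mathbf g^{\Sigma}_{ind})^{-1}(x)\big(\mathbf i_X\omega(x),\mathbf i_Y\omega(x)\big).$$ Normal metric: for $L\in\Sigma$ consider the decomposition $\mathfrak g=\mathfrak g_L\oplus\mathfrak g^L$, orthogonal with respect to $-\mathbf k$, where $\mathfrak g_L=\{X\in\mathfrak g\mid[L,X]=0\}$ and $\mathfrak g^L=\operatorname{Im}(\operatorname{ad}_L)$. For $X\in\mathfrak g$ let $X^L$ be its component in $\mathfrak g^L$. The tangent space is $T_L\Sigma=\{[L,X]\mid X\in\mathfrak g\}$, and $$\mathbf n^{\Sigma}([L,X],[L,Y])=-\mathbf k(X^L,Y^L),\qquad X,Y\in\mathfrak g.$$ *)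

(* Defs.v *)
From HB Require Import structures.
From mathcomp Require Import all_boot all_order all_algebra.
From mathcomp Require Import all_classical all_reals all_analysis.

Set Implicit Arguments.
Unset Strict Implicit.
Unset Printing Implicit Defensive.

Import Order.TTheory GRing.Theory Num.Theory.
Import numFieldNormedType.Exports.

Local Open Scope classical_set_scope.
Local Open Scope ring_scope.

HB.mixin Record Vector_isLie (R : realType) g of Vector R g := {
  lie_bracket : g -> g -> g;
  lie_bracket_linearl : forall y, linear (fun x => lie_bracket x y);
  lie_bracket_linearr : forall x, linear (lie_bracket x);
  lie_bracketxx : forall x, lie_bracket x x = 0;
  lie_jacobi : forall x y z,
    lie_bracket x (lie_bracket y z) + lie_bracket y (lie_bracket z x)
      + lie_bracket z (lie_bracket x y) = 0
}.

(* A finite-dimensional real Lie algebra carrying an arbitrary norm.  The norm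
   is unrelated to the bracket; since all norms on a finite-dimensional space
   are equivalent, it only provides the standard topology and smooth
   structure. *)
#[short(type="lieAlgType")]
HB.structure Definition LieAlg (R : realType) :=
  { g of NormedModule R g & Vector R g & Vector_isLie R g }.

Notation "[| x , y |]" := (lie_bracket x y)
  (at level 0, x, y at level 99, format "[| x ,  y |]") : ring_scope.

Section BilinearForms.
Variables (R : realType) (V : vectType R).

Definition dual : vectType R := 'Hom(V, R^o).
Definition form : vectType R := 'Hom(V, 'Hom(V, R^o)).

(* [linfun] returns a map agreeing with its argument when the latter is linear,
   so this is [f] itself as soon as [f] is bilinear. *)
Definition form_of (f : V -> V -> R) : form :=
  linfun (fun u => linfun (f u : V -> R^o) : 'Hom(V, R^o)).

(* The vector representing the covector [a] through the form [b]; it is unique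
   when [b] is nondegenerate. *)
Definition sharp (b : form) (a : V -> R) : V :=
  xget 0 [set v | forall w, b v w = a w].

Definition cometric (b : form) (a c : V -> R) : R :=
  b (sharp b a) (sharp b c).

Definition lfun_trace (f : 'End(V)) : R :=
  \tr (passmx.mxof (vbasis {:V}) (vbasis {:V}) f).

End BilinearForms.

Section LieAlgebra.
Variables (R : realType) (g : lieAlgType R).
Implicit Types (x y L : g) (F H : g -> R) (U I : {vspace g}).

Definition ad x : 'End(g) := linfun (lie_bracket x).

Definition killing : form g :=
  form_of (fun x y => lfun_trace (ad x \o ad y)%VF).

Definition commutator U : {vspace g} :=
  <<[seq [| x, y |] | x <- vbasis U, y <- vbasis U]>>%VS.

Definition solvable_space U := exists n, iter n commutator U = 0%VS.

Definition lie_ideal I := forall x y, y \in I -> [| x, y |] \in I.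

Definition semisimple_lie :=
  forall I, lie_ideal I -> solvable_space I -> I = 0%VS.

(* Compactness in the sense that [g] is the Lie algebra of a compact Lie group:
   there is an [ad]-invariant inner product.  Negative definiteness of the
   Killing form is a consequence of this and semisimplicity. *)
Definition compact_lie :=
  exists b : form g,
    [/\ forall x y, b x y = b y x,
        forall x, x != 0 -> 0 < b x x
      & forall z x y, b [| z, x |] y = - b x [| z, y |] ].

Fixpoint Ck (n : nat) F : Prop :=
  continuous F /\
  if n is m.+1 then
    forall v : g, (forall x, derivable F x v) /\ Ck m (fun x => 'D_v F x)
  else True.

Definition smooth F := forall n, Ck n F.

Definition gradient F L : g := sharp killing ('d F L).

Definition poisson_bracket F H L : R :=
  killing L [| gradient F L, gradient H L |].

Definition hamiltonian_field H L : g := - [| L, gradient H L |].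

(* The bivector [pi] with [{F, H}(L) = pi (dF(L)) (dH(L))]. *)
Definition poisson_tensor L : form (dual g) :=
  form_of (fun a c : 'Hom(g, R^o) => killing L [| sharp killing a, sharp killing c |]).

Definition poisson_rank L : nat := \dim (limg (poisson_tensor L)).

(* [exp (ad x) y] *)
Definition exp_ad x y : g :=
  lim (series (fun k => (k`!%:R)^-1 *: iter k (lie_bracket x) y) @ \oo).

(* The orbit of [L0] under the adjoint group, which is generated by the
   [exp (ad x)]. *)
Definition adjoint_orbit L0 : set g :=
  [set L | exists s : seq g, L = foldr exp_ad L0 s].

Definition is_adjoint_orbit (S : set g) := exists L0, S = adjoint_orbit L0.

Definition regular_leaf (S : set g) :=
  forall L, S L -> \forall L' \near L, poisson_rank L' = poisson_rank L.

(* The tangent space at [L] of the adjoint orbit through [L]. *)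
Definition tangent L : vectType R := subvs_of (limg (ad L)).

(* [vsproj] is the identity on the subspace, so this only restricts the type
   of vectors of the form [[L, x]]. *)
Definition to_tangent L (x : g) : tangent L := vsproj (limg (ad L)) x.

(* The value at [L] of the symplectic form of the leaf.  Every tangent vector
   is the value of some Hamiltonian field, so the condition determines it. *)
Definition symplectic_form L : form (tangent L) :=
  xget 0 [set w : form (tangent L) | forall F H, smooth F -> smooth H ->
    w (to_tangent L (hamiltonian_field F L))
      (to_tangent L (hamiltonian_field H L)) = poisson_bracket F H L].

Definition induced_metric L : form (tangent L) :=
  form_of (fun u v => killing (vsval u) (vsval v)).

Definition double_bracket_metric L (u v : tangent L) : R :=
  cometric (induced_metric L) (symplectic_form L u) (symplectic_form L v).

(* The component in [Im (ad L)] along [ker (ad L)]. *)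
Definition orbit_component L (x : g) : g :=
  daddv_pi (limg (ad L)) (lker (ad L)) x.

(* Tangent vectors are exactly the [[L, x]], so the condition determines the
   form. *)
Definition normal_form L : form (tangent L) :=
  xget 0 [set n : form (tangent L) | forall x y,
    n (to_tangent L [| L, x |]) (to_tangent L [| L, y |])
      = - killing (orbit_component L x) (orbit_component L y)].

Definition normal_metric L (u v : tangent L) : R := normal_form L u v.

End LieAlgebra.

Arguments compact_lie {R} g.
Arguments semisimple_lie {R} g.
Arguments is_adjoint_orbit {R g} S.
Arguments regular_leaf {R g} S.
Arguments double_bracket_metric {R g} L u v.
Arguments normal_metric {R g} L u v.

(* Main.v *)
From HB Require Import structures.
From mathcomp Require Import all_boot all_order all_algebra.
From mathcomp Require Import all_classical all_reals all_analysis.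
Require Import Defs.

(** Write k for the Killing form and x^L for the component of x in Im (ad L).

    Every tangent vector of the orbit at L is a bracket [L, x], and since k is
    ad-invariant the symplectic form is
      omega ([L, x], [L, y]) = k (L, [x, y]) = k ([L, x], y)
                             = - k (x^L, [L, y]).
    The last expression says that the covector omega ([L, x], .) is represented
    by the tangent vector - x^L through the metric induced by k
    ([sharp_symplectic]). The co-metric of the covectors of [L, x] and [L, y] is
    therefore k (x^L, y^L), which is minus the normal metric.

    For this computation to mean anything, three facts are needed.
    - k is negative definite ([killing_negative_definite]). An invariant inner
      product makes each ad x skew, so in an orthonormal basis (e_i) the trace
      of (ad x)^2 is - sum |[x, e_i]|^2; it vanishes only for central x, and the
      centre is an abelian ideal, hence zero. Definiteness makes representing
      vectors unique and splits g into Im (ad L) and Ker (ad L).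
    - The forms omega and n, given by the values they must take, exist.
      Both are written down with a linear section of ad L over its image
      ([antibracket]); invariance, respectively the vanishing of x^L on
      Ker (ad L), removes the dependence on the section.
    - omega is tested on smooth functions only, so there must be enough of them:
      the linear functional k (x, .) is smooth and has gradient x
      ([gradient_killing]). Smoothness of linear functionals for an arbitrary
      norm rests on the comparison of norms in finite dimension, which comes
      from the compactness of the unit sphere of R^n
      ([linear_rV_injective_lower_bound]). *)

Set Implicit Arguments.
Unset Strict Implicit.
Unset Printing Implicit Defensive.

Import Order.TTheory GRing.Theory Num.Theory.
Import numFieldNormedType.Exports.

Local Open Scope classical_set_scope.
Local Open Scope ring_scope.

(** * Linear maps and bilinear forms *)

Lemma linfunE (K : fieldType) (U V : vectType K) (f : U -> V) :
  linear f -> linfun f =1 f.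
Proof.
move=> f_lin x.
pose F : {linear U -> V} := HB.pack f (GRing.isLinear.Build _ _ _ _ f f_lin).
exact: (lfunE F x).
Qed.

Lemma form_ofE (R : realType) (V : vectType R) (f : V -> V -> R) :
  (forall v, linear (fun u => f u v : R^o)) ->
  (forall u, linear (f u : V -> R^o)) ->
  forall u v, form_of f u v = f u v.
Proof.
move=> f_linl f_linr u v; rewrite /form_of linfunE ?linfunE// => a x y.
apply/lfunP => w; rewrite add_lfunE scale_lfunE !linfunE//.
exact: f_linl.
Qed.

Section FormLeft.
Context {R : realType} {V : vectType R}.
Variable b : form V.

Lemma form0l w : b 0 w = 0.
Proof. by rewrite linear0 zero_lfunE. Qed.

Lemma formNl u w : b (- u) w = - b u w.
Proof. by rewrite [b _]linearN opp_lfunE. Qed.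

Lemma formBl u v w : b (u - v) w = b u w - b v w.
Proof. by rewrite [b _]linearB add_lfunE opp_lfunE. Qed.

Lemma formZl a u w : b (a *: u) w = a * b u w.
Proof. by rewrite [b _]linearZ scale_lfunE. Qed.

Lemma formZr a u w : b u (a *: w) = a * b u w.
Proof. by rewrite linearZ. Qed.

Lemma form_suml I (r : seq I) (F : I -> V) w :
  b (\sum_(i <- r) F i) w = \sum_(i <- r) b (F i) w.
Proof. by rewrite [b _]linear_sum sum_lfunE. Qed.

End FormLeft.

(** Two representatives of the same covector differ by a vector which is
    orthogonal to everything, in particular to itself. *)
Lemma sharpE (R : realType) (V : vectType R) (b : form V) (a : V -> R) v :
  (forall x, x != 0 -> b x x != 0) -> (forall w, b v w = a w) ->
  sharp b a = v.
Proof.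
move=> b_aniso bva; rewrite /sharp.
have sP : [set s | forall w, b s w = a w]
    (xget 0 [set s | forall w, b s w = a w]) by apply: xgetPex; exists v.
apply/eqP; rewrite -subr_eq0; apply: contraT => /b_aniso.
by rewrite formBl sP bva subrr eqxx.
Qed.

(** * Traces and orthonormal bases *)

Section Trace.
Context {R : realType} {V : vectType R}.
Implicit Types (f h : 'End(V)).

Lemma lfun_trace_linear : linear (@lfun_trace R V : _ -> R^o).
Proof. by move=> a f h; rewrite /lfun_trace passmx.mxof_linear linearP. Qed.

Lemma lfun_traceB f h : lfun_trace (f - h) = lfun_trace f - lfun_trace h.
Proof.
by rewrite addrC -scaleN1r lfun_trace_linear [X in X + _]mulN1r addrC.
Qed.

Lemma lfun_traceC f h :
  lfun_trace (f \o h)%VF = lfun_trace (h \o f)%VF.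
Proof.
by rewrite /lfun_trace !(passmx.mxof_comp _ _ (vbasisP _)) mxtrace_mulC.
Qed.

Lemma lfun_trace_basis (e : (\dim {:V}).-tuple V) f : basis_of {:V} e ->
  lfun_trace f = \sum_i coord e i (f e`_i).
Proof.
move=> eB; transitivity (\tr (passmx.mxof e e f)).
  rewrite /lfun_trace -[X in passmx.mxof (vbasis _) _ X]comp_lfun1r.
  rewrite (passmx.mxof_comp _ _ eB) mxtrace_mulC.
  by rewrite -(passmx.mxof_comp _ _ (vbasisP _)) comp_lfun1l.
by apply: eq_bigr => i _; rewrite !mxE /= passmx.vecof_delta.
Qed.

End Trace.

Section Orthonormal.
Context {R : realType} {V : vectType R}.
Variable b : form V.
Hypothesis bC : forall x y, b x y = b y x.
Hypothesis b_pos : forall x, x != 0 -> 0 < b x x.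

Definition orthonormal_family n (e : n.-tuple V) :=
  forall i j : 'I_n, b e`_i e`_j = (i == j)%:R.

Lemma orthonormal_sum n (e : n.-tuple V) (c : 'I_n -> R) (j : 'I_n) :
  orthonormal_family e -> b (\sum_i c i *: e`_i) e`_j = c j.
Proof.
move=> eO; rewrite form_suml (bigD1 j)//= formZl eO eqxx mulr1.
by rewrite big1 ?addr0// => i /negPf ij; rewrite formZl eO ij mulr0.
Qed.

Lemma orthonormal_free n (e : n.-tuple V) : orthonormal_family e -> free e.
Proof.
move=> eO; apply/freeP => c c0 i.
by rewrite -(orthonormal_sum c i eO) c0 form0l.
Qed.

(** One Gram-Schmidt step: a vector outside the span is made orthogonal to the
    family, then normalised. *)
Lemma orthonormal_extend n (e : n.-tuple V) :
  orthonormal_family e -> (n < \dim {:V})%N ->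
  exists e' : n.+1.-tuple V, orthonormal_family e'.
Proof.
move=> eO ltn.
have [x xNe] : exists x, x \notin <<e>>%VS.
  apply: contrapT => /forallNP eT; move: ltn; rewrite ltnNge => /negP; apply.
  rewrite -[leqRHS](size_tuple e); apply: leq_trans (dim_span _).
  by apply/dimvS/subvP => x _; apply: contrapT => /negP /eT.
pose y := x - \sum_(i < n) b x e`_i *: e`_i.
have y0 : y != 0.
  rewrite subr_eq0; apply: contraNneq xNe => ->; apply: memv_suml => i _.
  by apply: memvZ; apply: memv_span; rewrite mem_nth ?size_tuple.
have yO (i : 'I_n) : b y e`_i = 0.
  by rewrite formBl orthonormal_sum// subrr.
pose z := (Num.sqrt (b y y))^-1 *: y.
have zO (i : 'I_n) : b z e`_i = 0.
  by rewrite formZl yO mulr0.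
have zz : b z z = 1.
  rewrite /z formZl formZr mulrA -expr2 exprVn sqr_sqrtr ?ltW ?b_pos// mulVf//.
  by rewrite gt_eqF ?b_pos.
exists [tuple of z :: e] => i j.
case: (unliftP ord0 i) => [i' ->|->]; case: (unliftP ord0 j) => [j' ->|->] /=.
- by rewrite (inj_eq lift_inj) -eO.
- by rewrite bC; exact: zO.
- exact: zO.
- by rewrite zz.
Qed.

Lemma orthonormal_basis_exists :
  exists2 e : (\dim {:V}).-tuple V, basis_of {:V} e & orthonormal_family e.
Proof.
suff /(_ _ (leqnn _))[e eO] m : (m <= \dim {:V})%N ->
    exists e : m.-tuple V, orthonormal_family e.
  exists e => //.
  by rewrite basisEfree orthonormal_free// subvf size_tuple leqnn.
elim: m => [_|n IHn ltn]; first by exists [tuple] => -[].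
by have [e eO] := IHn (ltnW ltn); exact: orthonormal_extend eO ltn.
Qed.

Lemma trace_orthonormal (e : (\dim {:V}).-tuple V) f :
  basis_of {:V} e -> orthonormal_family e ->
  lfun_trace f = \sum_(i < \dim {:V}) b (f e`_i) e`_i.
Proof.
move=> eB eO; rewrite (lfun_trace_basis f eB); apply: eq_bigr => i _.
rewrite [in RHS](coord_basis eB (memvf (f e`_i))).
exact/esym/(orthonormal_sum (fun j => coord e j (f e`_i))).
Qed.

End Orthonormal.

(** * The Killing form *)

Section Killing.
Context {R : realType} {g : lieAlgType R}.
Implicit Types x y z : g.

Lemma adE x y : ad x y = [| x, y |].
Proof. by rewrite /ad linfunE//; exact: lie_bracket_linearr. Qed.

Lemma ad_linear : linear (@ad R g).
Proof.
move=> a x y; apply/lfunP => z.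
by rewrite add_lfunE scale_lfunE !adE lie_bracket_linearl.
Qed.

(** Polarisation of [lie_bracketxx] at x + y. *)
Lemma lie_bracketC x y : [| x, y |] = - [| y, x |].
Proof.
apply/eqP; rewrite -addr_eq0; apply/eqP.
have := lie_bracketxx (x + y).
have addl u v w : [| u + v, w |] = [| u, w |] + [| v, w |] :> g.
  by have := lie_bracket_linearl w 1 u v; rewrite !scale1r.
by rewrite addl -!adE !linearD/= !adE !lie_bracketxx add0r addr0.
Qed.

(** The Jacobi identity, read as saying that ad is a representation. *)
Lemma ad_bracket x y :
  ad [| x, y |] = (ad x \o ad y)%VF - (ad y \o ad x)%VF.
Proof.
apply/lfunP => z; rewrite add_lfunE opp_lfunE !comp_lfunE !adE; apply/eqP.
rewrite eq_sym subr_eq -subr_eq0 -[X in _ == X](lie_jacobi x y z).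
rewrite [[| z, [| x, y |] |]]lie_bracketC [[| z, x |]]lie_bracketC.
by rewrite -[[| y, - _ |]]adE linearN/= adE opprD addrAC addrA.
Qed.

Lemma killingE x y : killing g x y = lfun_trace (ad x \o ad y)%VF.
Proof.
rewrite /killing form_ofE// => w a u v.
  by rewrite ad_linear comp_lfunDl -comp_lfunZl lfun_trace_linear.
by rewrite ad_linear comp_lfunDr -comp_lfunZr lfun_trace_linear.
Qed.

(** Expanding both sides with [ad_bracket], the terms that do not agree on the
    nose are the traces of yxz and xzy, cyclic permutations of each other. *)
Lemma killing_bracketl x y z :
  killing g [| x, y |] z = killing g x [| y, z |].
Proof.
rewrite !killingE !ad_bracket comp_lfunDl comp_lfunDr comp_lfunNl comp_lfunNr.
rewrite !lfun_traceB comp_lfunA; congr (_ - _).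
by rewrite -[in LHS]comp_lfunA [LHS]lfun_traceC -comp_lfunA.
Qed.

Lemma killing_bracketr x y z :
  killing g x [| z, y |] = - killing g [| z, x |] y.
Proof. by rewrite -killing_bracketl lie_bracketC linearN opp_lfunE. Qed.

(** The centre, as the kernel of ad, is an ideal with zero commutator. *)
Lemma center_trivial x :
  semisimple_lie g -> (forall y, [| x, y |] = 0) -> x = 0.
Proof.
move=> ss x_central; pose Z := lker (linfun (@ad R g)).
have ZP y : (y \in Z) = (ad y == 0).
  by rewrite memv_ker linfunE//; exact: ad_linear.
suff Z0 : Z = 0%VS.
  apply/eqP; rewrite -memv0 -Z0 ZP; apply/eqP/lfunP => y.
  by rewrite adE x_central zero_lfunE.
apply: ss => [y z zZ | ].
  have z0 w : [| w, z |] = 0.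
    move: zZ; rewrite ZP lie_bracketC -adE => /eqP ->.
    by rewrite zero_lfunE oppr0.
  rewrite z0 ZP; apply/eqP/lfunP => w.
  by rewrite adE lie_bracketC -adE linear0 oppr0 zero_lfunE.
exists 1%N; apply/eqP; rewrite -subv0; apply/span_subvP.
move=> _ /allpairsP[[y z] /= [yZ _ ->]].
move/vbasis_mem: yZ; rewrite ZP => /eqP y0.
by rewrite -adE y0 zero_lfunE mem0v.
Qed.

(** In a basis (e_i) orthonormal for an invariant inner product b, k(x, x) is
    the sum of the b([x, [x, e_i]], e_i) = - b([x, e_i], [x, e_i]). *)
Lemma killing_negative_definite x :
  compact_lie g -> semisimple_lie g -> x != 0 -> killing g x x < 0.
Proof.
move=> [b [bC b_pos b_inv]] ss x0.
have [e eB eO] := orthonormal_basis_exists bC b_pos.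
have b_ge0 y : 0 <= b y y.
  by have [->|/b_pos/ltW//] := eqVneq y 0; rewrite linear0 lexx.
rewrite killingE (trace_orthonormal _ eB eO).
under eq_bigr do rewrite comp_lfunE !adE b_inv.
rewrite sumrN oppr_lt0 lt0r sumr_ge0// andbT.
apply: contraNneq x0 => /psumr_eq0P x0; apply/eqP/center_trivial => // y.
rewrite -adE (coord_basis eB (memvf y)) linear_sum big1// => i _.
rewrite linearZ/= adE; have [->|/b_pos] := eqVneq [| x, e`_i |] 0.
  by rewrite scaler0.
by rewrite x0 ?ltxx.
Qed.

End Killing.

(** * Linear maps out of a finite-dimensional normed space *)

Section Continuity.
Context {R : realType}.

Lemma le_coord_mx_norm n (u : 'rV[R]_n) i : `|u 0 i| <= `|u|.
Proof.
rewrite [leRHS]/Num.norm/= mx_normrE.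
by apply/bigmax_geP; right; exists (0, i).
Qed.

Lemma linear_rV_bounded (V : normedModType R) n (f : {linear 'rV[R]_n -> V}) :
  exists2 M, 0 <= M & forall u, `|f u| <= M * `|u|.
Proof.
exists (\sum_i `|f (delta_mx 0 i)|) => [ |u]; first exact: sumr_ge0.
rewrite [in leLHS](row_sum_delta u) linear_sum mulr_suml.
apply: le_trans (ler_norm_sum _ _ _) _; apply: ler_sum => i _.
by rewrite linearZ/= normrZ mulrC ler_wpM2l// le_coord_mx_norm.
Qed.

Lemma le_linear_continuous (V W : normedModType R) (f : {linear V -> W}) M :
  (forall x, `|f x| <= M * `|x|) -> continuous f.
Proof.
move=> fM; suff : bounded_near f (nbhs (0 : V)).
  exact: bounded_linear_continuous.
apply/linear_boundedP; near=> r => x; apply: le_trans (fM x) _.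
by rewrite ler_wpM2r//; near: r; exact: nbhs_pinfty_ge.
Unshelve. all: by end_near. Qed.

(** The continuous function |f| has a minimum on the compact unit sphere, and
    injectivity makes this minimum positive. *)
Lemma linear_rV_injective_lower_bound (V : normedModType R) n
    (f : {linear 'rV[R]_n -> V}) :
  injective f -> exists2 m, 0 < m & forall u, m * `|u| <= `|f u|.
Proof.
move=> f_inj; have [M _ fM] := linear_rV_bounded f.
have f_cont := le_linear_continuous fM.
pose S := [set u : 'rV[R]_n | `|u| = 1].
(* The sphere is empty when n = 0. *)
have [S0|/set0P S0] := eqVneq S set0.
  exists 1 => // u; have [->|u0] := eqVneq u 0; first by rewrite normr0 mulr0.
  have : S (`|u|^-1 *: u).
    by rewrite /S/= normrZ normfV normr_id mulVf// normr_eq0.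
  by rewrite S0.
have S_compact : compact S.
  apply: bounded_closed_compact.
    by exists 1; split => // r r1 u; rewrite /S/= => ->; exact: ltW.
  rewrite (_ : S = (@Num.norm _ 'rV[R]_n) @^-1` [set 1])//.
  apply: closed_comp; last exact: closed_eq.
  by move=> u _; exact: norm_continuous.
have [ |c cS cmin] := @compact_EVT_min _ _ (fun u => `|f u|) S S0 S_compact.
  apply: continuous_subspaceT => u.
  by apply: continuous_comp; [exact: f_cont|exact: norm_continuous].
exists `|f c|.
  rewrite normr_gt0; apply/eqP => fc0; move: cS; rewrite inE /S/=.
  by rewrite (f_inj c 0) ?normr0 ?linear0// => /esym/eqP; rewrite oner_eq0.
move=> u; have [->|u0] := eqVneq u 0; first by rewrite normr0 mulr0.
have := cmin (`|u|^-1 *: u).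
rewrite inE /S/= normrZ normfV normr_id mulVf ?normr_eq0// => /(_ erefl).
by rewrite linearZ/= normrZ normfV normr_id mulrC ler_pdivlMr// normr_gt0.
Qed.

Variable g : lieAlgType R.

(** In the coordinates of a basis f is bounded; the coordinate isomorphism has a
    bounded inverse by [linear_rV_injective_lower_bound]. *)
Lemma linear_continuous (W : normedModType R) (f : {linear g -> W}) :
  continuous f.
Proof.
pose e := vbasis {:g}; have eB : basis_of {:g} e := vbasisP _.
have vec_lin : linear (passmx.vecof e : _ -> g) := passmx.vecof_linear e.
pose vec : {linear 'rV[R]_(\dim {:g}) -> g} :=
  HB.pack (passmx.vecof e : _ -> g) (GRing.isLinear.Build _ _ _ _ _ vec_lin).
have vecK : cancel (passmx.rVof e) vec := passmx.rVofK eB.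
have vec_inj : injective vec := can_inj (passmx.vecofK eB).
have [m m0 vec_ge] := linear_rV_injective_lower_bound vec_inj.
pose h : {linear 'rV[R]_(\dim {:g}) -> W} := f \o vec.
have [M M0 hM] := linear_rV_bounded h.
apply: (@le_linear_continuous _ _ f (M / m)) => x.
rewrite -(vecK x) (le_trans (hM _))// -mulrA ler_wpM2l//.
by rewrite ler_pdivlMl.
Qed.

Lemma Ck_cst n (c : R) : Ck n (fun _ : g => c).
Proof.
elim: n c => [ |n IHn] c; first by split => // x; exact: cvg_cst.
split => [x|v]; first exact: cvg_cst.
split => [x | ]; first exact: derivable_cst.
suff -> : (fun x => 'D_v (fun _ : g => c : R^o) x) = (fun=> 0) by exact: IHn.
by apply/funext => x; exact: derive_cst.
Qed.

Lemma linear_smooth (f : {linear g -> R^o}) : smooth (f : g -> R).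
Proof.
have f_cont : continuous (f : g -> R^o) := @linear_continuous _ f.
case=> [ |n]; first by [].
split => // v; split => [x | ].
  exact/diff_derivable/linear_differentiable.
rewrite (_ : (fun x => _) = fun=> f v); first exact: Ck_cst.
apply/funext => x; rewrite deriveE; last exact: linear_differentiable.
by rewrite diff_lin.
Qed.

End Continuity.

(** * The two metrics of an adjoint orbit *)

Section Orbit.
Context {R : realType} {g : lieAlgType R}.
Hypothesis killing_lt0 : forall x : g, x != 0 -> killing g x x < 0.
Implicit Types x y z L : g.

Lemma killing_anisotropic x : x != 0 -> killing g x x != 0.
Proof. by move=> /killing_lt0; rewrite lt_neqAle => /andP[]. Qed.

(** The functions k(x, .) realise every vector as a gradient, hence every
    tangent vector of the orbit as the value of a Hamiltonian field. *)
Lemma gradient_killing x L : gradient (killing g x : g -> R) L = x.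
Proof.
apply: sharpE; first exact: killing_anisotropic.
move=> w; rewrite (@diff_lin _ _ R^o (killing g x))//.
exact: linear_continuous.
Qed.

Section Point.
Variable L : g.

Lemma bracket_in_limg x : [| L, x |] \in limg (ad L).
Proof. by rewrite -adE memv_img ?memvf. Qed.

Lemma tangentP (u : tangent L) : exists x, u = to_tangent L [| L, x |].
Proof.
have /memv_imgP[x _ ux] := subvsP u; exists x.
by rewrite /to_tangent -adE -ux vsvalK.
Qed.

Lemma val_to_tangent x : vsval (to_tangent L [| L, x |]) = [| L, x |].
Proof. by rewrite vsprojK// bracket_in_limg. Qed.

(** If [L, [L, y]] = 0 then [L, y] is k-isotropic, by invariance. *)
Lemma limg_ker_capv0 : (limg (ad L) :&: lker (ad L) = 0)%VS.
Proof.
apply/eqP; rewrite -subv0; apply/subvP => x; rewrite memv_cap => /andP[].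
move=> /memv_imgP[y _ ->]; rewrite memv_ker !adE => /eqP LLy; rewrite memv0.
apply: contraT => /killing_lt0.
by rewrite killing_bracketr LLy form0l oppr0 ltxx.
Qed.

Lemma limg_ker_full : (limg (ad L) + lker (ad L) = fullv)%VS.
Proof.
apply/eqP; rewrite eqEdim subvf/= dimv_disjoint_sum ?limg_ker_capv0//.
by rewrite addnC -[in leqLHS](limg_ker_dim (ad L)) capfv.
Qed.

Lemma bracket_orbit_component x : [| L, orbit_component L x |] = [| L, x |].
Proof.
have := daddv_pi_add limg_ker_capv0 (w := x); rewrite limg_ker_full memvf.
move=> /(_ isT) {2}<-; rewrite -!adE linearD/=.
have : daddv_pi (lker (ad L)) (limg (ad L)) x \in lker (ad L) by exact: memv_pi.
by rewrite memv_ker => /eqP ->; rewrite addr0.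
Qed.

Lemma orbit_component_ker x : [| L, x |] = 0 -> orbit_component L x = 0.
Proof.
move=> Lx; apply/eqP; rewrite -memv0 -limg_ker_capv0 memv_cap memv_pi/=.
by rewrite memv_ker adE bracket_orbit_component Lx.
Qed.

(** A linear section of ad L over its image: a tangent vector [L, x] determines
    x only up to Ker (ad L), so defining a form on tangent vectors by a formula
    in x requires a linear choice of x. *)
Definition antibracket (u : tangent L) : g := ((ad L)^-1)%VF (vsval u).

Lemma antibracketK x :
  [| L, antibracket (to_tangent L [| L, x |]) |] = [| L, x |].
Proof. by rewrite -adE limg_lfunVK val_to_tangent ?bracket_in_limg. Qed.

Lemma antibracket_linear : linear antibracket.
Proof. by move=> a u v; rewrite /antibracket !linearP. Qed.

Lemma induced_metricE u v :
  induced_metric L u v = killing g (vsval u) (vsval v).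
Proof.
by rewrite form_ofE// => w a x y; rewrite !linearP// add_lfunE scale_lfunE.
Qed.

(** The defining condition of the normal form is consistent because x^L depends
    on [L, x] only. *)
Lemma normal_formE x y :
  normal_form L (to_tangent L [| L, x |]) (to_tangent L [| L, y |])
    = - killing g (orbit_component L x) (orbit_component L y).
Proof.
suff /xgetPex/(_ x y) : exists n : form (tangent L), forall x y,
  n (to_tangent L [| L, x |]) (to_tangent L [| L, y |])
    = - killing g (orbit_component L x) (orbit_component L y) by exact.
pose c u := orbit_component L (antibracket u).
have cE z : c (to_tangent L [| L, z |]) = orbit_component L z.
  apply/eqP; rewrite -subr_eq0 -linearB/=; apply/eqP/orbit_component_ker.
  by rewrite -adE linearB/= !adE antibracketK subrr.
exists (form_of (fun u v => - killing g (c u) (c v))) => {}x {}y.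
have c_lin : linear c.
  by move=> a u v; rewrite /c antibracket_linear /orbit_component linearP.
rewrite form_ofE ?cE// => w a u v.
  by rewrite c_lin linearP add_lfunE scale_lfunE opprD [_ *: - _]mulrN.
by rewrite c_lin linearP opprD [_ *: - _]mulrN.
Qed.

(** The form u, v |-> k(u, y) with [L, y] = v satisfies the defining condition,
    so the symplectic form does too; it is then evaluated on the Hamiltonian
    fields of the linear functions k(-x, .) and k(-y, .). *)
Lemma symplectic_formE x y :
  symplectic_form L (to_tangent L [| L, x |]) (to_tangent L [| L, y |])
    = killing g [| L, x |] y.
Proof.
have brN z : - [| L, - z |] = [| L, z |] by rewrite -adE linearN/= adE opprK.
suff /(@xgetPex _ 0) symP : exists w : form (tangent L),
    forall F H : g -> R, smooth F -> smooth H ->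
    w (to_tangent L (hamiltonian_field F L))
      (to_tangent L (hamiltonian_field H L)) = poisson_bracket F H L.
  have := symP _ _ (linear_smooth (killing g (- x)))
                   (linear_smooth (killing g (- y))).
  rewrite /hamiltonian_field /poisson_bracket !gradient_killing !brN => ->.
  by rewrite -killing_bracketl linearN -formNl brN.
exists (form_of (fun u v => killing g (vsval u) (antibracket v))) => F H _ _.
rewrite form_ofE => [ | w a u v | w a u v]; last 2 first.
- by rewrite !linearP add_lfunE scale_lfunE.
- by rewrite antibracket_linear linearP.
have hamE K : hamiltonian_field K L = [| L, - gradient K L |].
  by rewrite -brN opprK.
rewrite !hamE val_to_tangent -[LHS]opprK -killing_bracketr.
rewrite antibracketK killing_bracketr opprK.
by rewrite linearN -formNl brN killing_bracketl.
Qed.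

(** k([L, x], y) = - k(x^L, [L, y]) by invariance, since x^L has the same
    bracket with L as x; and x^L is a tangent vector. *)
Lemma sharp_symplectic x :
  sharp (induced_metric L) (symplectic_form L (to_tangent L [| L, x |]))
    = to_tangent L (- orbit_component L x).
Proof.
have comp_in : - orbit_component L x \in limg (ad L) by rewrite rpredN memv_pi.
apply: sharpE => [u u0|u].
  by rewrite induced_metricE killing_anisotropic.
have [y ->] := tangentP u.
rewrite symplectic_formE induced_metricE val_to_tangent vsprojK//.
by rewrite formNl killing_bracketr opprK bracket_orbit_component.
Qed.

Lemma double_bracket_metricE u v :
  double_bracket_metric L u v = - normal_metric L u v.
Proof.
have [x ->] := tangentP u; have [y ->] := tangentP v.
rewrite /double_bracket_metric /cometric !sharp_symplectic induced_metricE.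
rewrite !vsprojK ?rpredN ?memv_pi// /normal_metric normal_formE opprK.
by rewrite formNl linearN opprK.
Qed.

End Point.
End Orbit.

Theorem theorem2p3 (R : realType) (g : lieAlgType R)
    (g_compact : compact_lie g) (g_semisimple : semisimple_lie g)
    (Sigma : set g) (Sigma_orbit : is_adjoint_orbit Sigma)
    (Sigma_regular : regular_leaf Sigma)
    (L : g) (L_in_Sigma : Sigma L) (u v : tangent L) :
  double_bracket_metric L u v = - normal_metric L u v.
Proof.
apply: double_bracket_metricE => x.
exact: killing_negative_definite.
Qed.
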